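(* Let $\mathbb Z_n$ denote the cyclic group of order $n$, let $\mathbb Z_2^3=\mathbb Z_2\times\mathbb Z_2\times\mathbb Z_2$, and let $Q_8=\langle a,b : a^4=1,\ b^2=a^2,\ ab=ba^{-1}\rangle$ be the quaternion group of order $8$. Then $$\mathcal S(\mathbb Z_4\times\mathbb Z_2)=\{8m+1 : m\in\mathbb Z\}\cup\{2^8m : m\in\mathbb Z\},$$ $$\mathcal S(Q_8)=\mathcal S(\mathbb Z_4\times\mathbb Z_2)\cup\{(8m-3)p^2 : m\in\mathbb Z,\ p\equiv 3 \pmod 4 \text{ prime}\},$$ and $$\mathcal S(\mathbb Z_2^3)=\{8m+1 : m\in\mathbb Z\}\cup\{2^8(4m+1): m\in\mathbb Z\}\cup\{2^{12}m : m\in\mathbb Z\}.$$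
   Context: For a finite group $G=\{g_1,\dots,g_n\}$, assign an independent variable $x_g$ to each $g\in G$; the group determinant $\mathscr D_G(x_{g_1},\dots,x_{g_n})$ is the determinant of the $n\times n$ matrix whose $(i,j)$ entry is $x_{g_ig_j^{-1}}$. Define $\mathcal S(G)=\{\mathscr D_G(x_{g_1},\dots,x_{g_n}) : x_{g_1},\dots,x_{g_n}\in\mathbb Z\}$, the set of integer values of the group determinant at integer arguments. *)

(* Defs.v *)
From HB Require Import structures.
From mathcomp Require Import all_boot all_order all_algebra all_fingroup all_solvable.
From mathcomp Require Import all_classical.

Set Implicit Arguments.
Unset Strict Implicit.
Unset Printing Implicit Defensive.

Import GRing.Theory.
Local Open Scope ring_scope.

(* [enum_val : 'I_#|gT| -> gT] lists the elements g_1, ..., g_n of the group.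
   The family of variables x : gT -> R takes its values in an arbitrary
   commutative ring. *)
Definition group_det (R : comNzRingType) (gT : finGroupType) (x : gT -> R) : R :=
  \det (\matrix_(i < #|gT|, j < #|gT|) x (enum_val i * (enum_val j)^-1)%g).

Definition int_group_dets (gT : finGroupType) : set int :=
  [set group_det x | x in [set: gT -> int]]%classic.

(* The library builds 'Q_8 as a quotient of a semidirect product; this is the
   usual presentation <a, b : a^4 = 1, b^2 = a^2, ab = ba^-1>. *)
Lemma Q8_presentation :
  ([set: 'Q_8] \isog
    Grp (a : b : (a ^+ 4, b ^+ 2 = a ^+ 2, a * b = b * a^-1)))%g.
Proof.
have /= iso := @Grp_quaternion 3 isT.
move=> rT H; rewrite iso; apply/existsP/existsP => -[[a b] /=];
  rewrite !xpair_eqE => /and4P[gen a4 b2 ab]; exists (a, b);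
  rewrite /= !xpair_eqE gen a4 b2 /=.
- by rewrite conjgC (eqP ab).
- by apply/eqP/(mulgI b); rewrite -conjgC (eqP ab).
Qed.

(* Main.v *)
Require Import Defs.
From HB Require Import structures.
From mathcomp Require Import all_boot all_order all_algebra all_fingroup all_solvable.
From mathcomp Require Import all_classical.
From mathcomp Require Import zify ring.

(** Each of the three groups has a central involution z with Klein quotient.
    Ordering the elements as r_0, ..., r_3, z r_0, ..., z r_3 turns the group
    matrix into a block matrix [[P, Q], [Q, P]], so that the group determinant
    is det(P + Q) det(P - Q).  The first factor is the Klein four-group
    determinant in s_i = x(r_i) + x(z r_i), the second a quartic form in
    t_i = x(r_i) - x(z r_i) depending on the group: the Klein determinant again
    for Z_2^3, a product of two Gaussian norms for Z_4 x Z_2, and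
    (t_0^2 + t_1^2 + t_2^2 + t_3^2)^2 for Q_8.  As s_i and t_i are subject only
    to s_i = t_i mod 2, the necessary conditions are 2-adic, split according to
    the parities of the s_i.  If three t_i are odd, the quaternion norm is
    3 mod 4, hence divisible by a prime p = 3 mod 4; conversely such a p is a
    sum of four squares, exactly three of them odd. *)

Set Implicit Arguments.
Unset Strict Implicit.
Unset Printing Implicit Defensive.

Import Order.TTheory GRing.Theory Num.Theory.
Local Open Scope ring_scope.

(** * Determinants *)

(** Two enumerations differ by a permutation acting on rows and columns alike, so its sign
    cancels. *)
Lemma det_reindex (R : comNzRingType) (T : finType) (n m : nat)
    (F : T -> T -> R) (e : 'I_n -> T) (f : 'I_m -> T) :
  bijective e -> bijective f ->
  \det (\matrix_(i, j) F (e i) (e j)) = \det (\matrix_(i, j) F (f i) (f j)).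
Proof.
move=> e_bij f_bij.
have nm : n = m by have := bij_eq_card e_bij; rewrite -(bij_eq_card f_bij) !card_ord.
subst m; have [e' ee' e'e] := e_bij.
have s_inj : injective (e' \o f) by apply: inj_comp (can_inj e'e) (bij_inj f_bij).
pose s := perm s_inj.
have -> : \matrix_(i, j) F (f i) (f j) =
    row_perm s (col_perm s (\matrix_(i, j) F (e i) (e j))).
  by apply/matrixP=> i j; rewrite !mxE !permE /= !e'e.
rewrite row_permE col_permE !det_mulmx !det_perm mulrCA.
by rewrite odd_permV -signr_addb addbb mulr1.
Qed.

Lemma group_det_reindex (R : comNzRingType) (gT : finGroupType) (x : gT -> R)
    (n : nat) (f : 'I_n -> gT) : bijective f ->
  group_det x = \det (\matrix_(i, j) x (f i * (f j)^-1)%g).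
Proof.
move=> f_bij; exact: (det_reindex (fun g h => x (g * h^-1)%g)) (@enum_val_bij _) _.
Qed.

(** Conjugation by the unipotent block matrix with rows (1, 0) and (1, 1) makes the matrix block
    triangular. *)
Lemma det_block_circulant (R : comNzRingType) n (P Q : 'M[R]_n) :
  \det (block_mx P Q Q P) = \det (P + Q) * \det (P - Q).
Proof.
have -> : block_mx P Q Q P = block_mx 1%:M 0 1%:M 1%:M *m
    block_mx (P + Q) Q 0 (P - Q) *m block_mx 1%:M 0 (- 1%:M) 1%:M.
  rewrite !mulmx_block !(mul1mx, mulmx1, mul0mx, mulmx0, addr0, add0r).
  rewrite !(mulmxN, mulmx1); congr block_mx.
  - by rewrite addrK.
  - by rewrite [Q + _]addrC subrK [P + Q]addrC addrK.
  - by rewrite addrC subrK.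
by rewrite !det_mulmx !det_lblock det_ublock !det1 !(mul1r, mulr1).
Qed.

(** * The quartic forms modulo powers of 2 *)

(** The factors are the values of the four characters of the Klein group. *)
Definition klein_form (s0 s1 s2 s3 : int) : int :=
  (s0 + s1 + s2 + s3) * (s0 + s1 - s2 - s3) *
  ((s0 - s1 + s2 - s3) * (s0 - s1 - s2 + s3)).

(** The norms of (t0 + t2) + i(t1 + t3) and (t0 - t2) + i(t1 - t3): the characters of Z_4 x Z_2
    sending z to -1, paired with their conjugates. *)
Definition gauss_form (t0 t1 t2 t3 : int) : int :=
  ((t0 + t2) ^+ 2 + (t1 + t3) ^+ 2) * ((t0 - t2) ^+ 2 + (t1 - t3) ^+ 2).

Definition norm_form (t0 t1 t2 t3 : int) : int :=
  t0 ^+ 2 + t1 ^+ 2 + t2 ^+ 2 + t3 ^+ 2.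

Lemma odd_square_mod8 (x : int) : (x %% 2)%Z = 1 -> (x ^+ 2 %% 8)%Z = 1.
Proof.
move=> hx; have -> : x = 4 * (x %/ 4)%Z + (x %% 4)%Z by lia.
have : (x %% 4)%Z = 1 \/ (x %% 4)%Z = 3 by lia.
by rewrite expr2; case=> ->; lia.
Qed.

Lemma int_parityE (x : int) : exists k (b : bool), x = 2 * k + b%:Z.
Proof. by exists (x %/ 2)%Z, ((x %% 2)%Z == 1); lia. Qed.

Lemma square_mod4 (x : int) : (x ^+ 2 %% 4)%Z = (x %% 2)%Z.
Proof. by have [k [[] ->]] := int_parityE x; rewrite expr2; lia. Qed.

(** With one odd entry both products are even; with three, exactly one product is odd. *)
Lemma pair_products_mod4 (a b c d : int) : ((a + b + c + d) %% 2)%Z = 1 ->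
  ((2 * (a * b + c * d)) %% 4)%Z =
  (((a %% 2)%Z + (b %% 2)%Z + (c %% 2)%Z + (d %% 2)%Z - 1) %% 4)%Z.
Proof.
have [a' [[] ->]] := int_parityE a; have [b' [[] ->]] := int_parityE b;
  have [c' [[] ->]] := int_parityE c; have [d' [[] ->]] := int_parityE d; lia.
Qed.

(** As q is odd, the value is 1 - 4w = 3 - 2n mod 8, which equals 2n - 1 because n is odd. In use, n
    counts odd variables. *)
Lemma odd_square_sub_mod8 (q w n : int) : (q %% 2)%Z = 1 ->
  ((2 * w) %% 4)%Z = ((n - 1) %% 4)%Z ->
  ((q ^+ 2 - 4 * (q * w)) %% 8)%Z = ((2 * n - 1) %% 8)%Z.
Proof.
move=> q_odd w_n; have q2 := odd_square_mod8 q_odd.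
have [v ->] : exists v, q ^+ 2 = 1 + 8 * v by exists (q ^+ 2 %/ 8)%Z; lia.
have [u ->] : exists u, n = 1 + 2 * w + 4 * u.
  by exists ((n - 1 - 2 * w) %/ 4)%Z; lia.
have [k ->] : exists k, q = 2 * k + 1 by exists (q %/ 2)%Z; lia.
by clear; lia.
Qed.

(** The first two factors multiply to q and the last two to q - 4(s0 s1 - s2 s3). The residue is 1
    for one odd variable and 5 for three. *)
Lemma klein_form_odd s0 s1 s2 s3 : ((s0 + s1 + s2 + s3) %% 2)%Z = 1 ->
  (klein_form s0 s1 s2 s3 %% 8)%Z =
  ((2 * ((s0 %% 2)%Z + (s1 %% 2)%Z + (s2 %% 2)%Z + (s3 %% 2)%Z) - 1) %% 8)%Z.
Proof.
move=> hs; pose q := (s0 + s1) ^+ 2 - (s2 + s3) ^+ 2.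
have -> : klein_form s0 s1 s2 s3 = q ^+ 2 - 4 * (q * (s0 * s1 - s2 * s3)).
  by rewrite /klein_form /q; ring.
have q_odd : (q %% 2)%Z = 1.
  have := square_mod4 (s0 + s1); have := square_mod4 (s2 + s3).
  by rewrite /q; lia.
apply: odd_square_sub_mod8 => //; rewrite -(pair_products_mod4 hs); clear; lia.
Qed.

(** The two norms are q and q - 4(t0 t2 + t1 t3), so the residue is the same as for [klein_form];
    with matching parities the product of the two forms is 1 mod 8. *)
Lemma gauss_form_odd t0 t1 t2 t3 : ((t0 + t1 + t2 + t3) %% 2)%Z = 1 ->
  (gauss_form t0 t1 t2 t3 %% 8)%Z =
  ((2 * ((t0 %% 2)%Z + (t1 %% 2)%Z + (t2 %% 2)%Z + (t3 %% 2)%Z) - 1) %% 8)%Z.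
Proof.
move=> ht; pose q := (t0 + t2) ^+ 2 + (t1 + t3) ^+ 2.
have -> : gauss_form t0 t1 t2 t3 = q ^+ 2 - 4 * (q * (t0 * t2 + t1 * t3)).
  by rewrite /gauss_form /q; ring.
have q_odd : (q %% 2)%Z = 1.
  have := square_mod4 (t0 + t2); have := square_mod4 (t1 + t3).
  by rewrite /q; lia.
have ht' : ((t0 + t2 + t1 + t3) %% 2)%Z = 1 by lia.
by apply: odd_square_sub_mod8 => //; rewrite (pair_products_mod4 ht'); clear; lia.
Qed.

Lemma norm_form_mod4 t0 t1 t2 t3 : (norm_form t0 t1 t2 t3 %% 4)%Z =
  (((t0 %% 2)%Z + (t1 %% 2)%Z + (t2 %% 2)%Z + (t3 %% 2)%Z) %% 4)%Z.
Proof.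
have := (square_mod4 t0, square_mod4 t1, square_mod4 t2, square_mod4 t3).
by rewrite /norm_form => -[[[]]]; lia.
Qed.

Lemma dvd4_prod4 (a b c d : int) :
  (a %% 2)%Z + (b %% 2)%Z + (c %% 2)%Z + (d %% 2)%Z <= 2 ->
  (4 %| a * b * (c * d))%Z.
Proof.
have [a' [[] ->]] := int_parityE a; have [b' [[] ->]] := int_parityE b;
  have [c' [[] ->]] := int_parityE c; have [d' [[] ->]] := int_parityE d; lia.
Qed.

(** Exactly two variables are odd. All four factors are even, and two of their halves are even
    again: of s1 + s2, s1 + s3, s2 + s3 exactly one is even. *)
Lemma klein_form_mixed s0 s1 s2 s3 : ((s0 + s1 + s2 + s3) %% 2)%Z = 0 ->
  [|| (s1 != s0 %[mod 2])%Z, (s2 != s0 %[mod 2])%Z | (s3 != s0 %[mod 2])%Z] ->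
  (64 %| klein_form s0 s1 s2 s3)%Z.
Proof.
move=> hs mixed; pose h := ((s0 + s1 + s2 + s3) %/ 2)%Z.
have -> : klein_form s0 s1 s2 s3 =
    16 * (h * (h - s1 - s2) * ((h - s1 - s3) * (h - s2 - s3))).
  have -> : s0 = 2 * h - s1 - s2 - s3 by rewrite /h; lia.
  by rewrite /klein_form; ring.
by rewrite (@dvdz_mul2l 16 4) //; apply: dvd4_prod4; lia.
Qed.

Lemma klein_form_double u0 u1 u2 u3 :
  (klein_form (2 * u0) (2 * u1) (2 * u2) (2 * u3) %% 64)%Z = 16 \/
  (256 %| klein_form (2 * u0) (2 * u1) (2 * u2) (2 * u3))%Z.
Proof.
have -> : klein_form (2 * u0) (2 * u1) (2 * u2) (2 * u3) =
    16 * klein_form u0 u1 u2 u3 by rewrite /klein_form; ring.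
have [hu|hu] : ((u0 + u1 + u2 + u3) %% 2)%Z = 1 \/
    ((u0 + u1 + u2 + u3) %% 2)%Z = 0 by lia.
- by left; have := klein_form_odd hu; lia.
- right; rewrite (@dvdz_mul2l 16 16) //.
  rewrite /klein_form -[16]/(2 * 2 * (2 * 2) : int).
  by do !apply: dvdz_mul; lia.
Qed.

(** Compared with [klein_form_double], only the first halved factor changes, from the sum of the u_i
    to that sum plus 2. When the sum is odd, this turns the cofactor of 16 from 1 into 3 mod 4. *)
Lemma klein_form_all_odd u0 u1 u2 u3 :
  (klein_form (2 * u0 + 1) (2 * u1 + 1) (2 * u2 + 1) (2 * u3 + 1) %% 64)%Z = 48 \/
  (256 %| klein_form (2 * u0 + 1) (2 * u1 + 1) (2 * u2 + 1) (2 * u3 + 1))%Z.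
Proof.
have -> : klein_form (2 * u0 + 1) (2 * u1 + 1) (2 * u2 + 1) (2 * u3 + 1) =
    16 * ((u0 + u1 + u2 + u3 + 2) * (u0 + u1 - u2 - u3) *
          ((u0 - u1 + u2 - u3) * (u0 - u1 - u2 + u3))).
  by rewrite /klein_form; ring.
have [hu|hu] : ((u0 + u1 + u2 + u3) %% 2)%Z = 1 \/
    ((u0 + u1 + u2 + u3) %% 2)%Z = 0 by lia.
- left.
  have [k ->] : exists k, u3 = 2 * k + 1 - u0 - u1 - u2.
    by exists ((u0 + u1 + u2 + u3) %/ 2)%Z; lia.
  have [k' [b ->]] := int_parityE k; case: b; lia.
- right; rewrite (@dvdz_mul2l 16 16) // -[16]/(2 * 2 * (2 * 2) : int).
  by do !apply: dvdz_mul; lia.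
Qed.

Lemma gauss_form_even t0 t1 t2 t3 : ((t0 + t1 + t2 + t3) %% 2)%Z = 0 ->
  (4 %| gauss_form t0 t1 t2 t3)%Z.
Proof.
move=> ht; rewrite -[4]/(2 * 2 : int).
have := (square_mod4 (t0 + t2), square_mod4 (t1 + t3)).
have := (square_mod4 (t0 - t2), square_mod4 (t1 - t3)).
by rewrite /gauss_form => -[? ?] [? ?]; apply: dvdz_mul; lia.
Qed.

(** * Primes and sums of four squares *)

(** If the least prime factor is 1 mod 4, the cofactor is still 3 mod 4 and the induction continues
    with it. *)
Lemma prime_factor_3mod4 (n : nat) : n = 3 %[mod 4] ->
  exists p, [/\ prime p, p = 3 %[mod 4] & (p %| n)%N].
Proof.
elim/ltn_ind: n => n IHn hn; have n_gt1 : (1 < n)%N by lia.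
have p_pr := pdiv_prime n_gt1; have p_gt1 := prime_gt1 p_pr.
have /dvdnP[k def_n] := pdiv_dvd n.
have [p3|p3] := eqVneq (pdiv n %% 4)%N 3.
  by exists (pdiv n); rewrite pdiv_dvd.
set p := pdiv n in p_pr p_gt1 def_n p3 *.
have [j def_p] : exists j, p = (4 * j + 1)%N.
  have : (p %% 4 = 0 \/ p %% 4 = 2 \/ p %% 4 = 1)%N by lia.
  case=> [h|[h|h]]; last by exists (p %/ 4)%N; lia.
  - have : (n %% 2)%N = 0 by rewrite def_n (divn_eq p 4) h; lia.
    by lia.
  - have : (n %% 2)%N = 0 by rewrite def_n (divn_eq p 4) h; lia.
    by lia.
have [||q [q_pr q3 qk]] := IHn k.
- by nia.
- by move: hn; rewrite def_n def_p; lia.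
by exists q; rewrite def_n dvdn_mulr.
Qed.

(** Pigeonhole: the (p + 1)/2 residues x^2 and the (p + 1)/2 residues -1 - y^2 are distinct within
    each family, so the families meet. *)
Lemma dvdn_square_sum_succ (p : nat) : prime p -> odd p ->
  exists x y : nat,
    [/\ (2 * x < p)%N, (2 * y < p)%N & (p %| x ^ 2 + y ^ 2 + 1)%N].
Proof.
move=> p_pr p_odd; have p_gt0 := prime_gt0 p_pr.
pose h := p./2.+1.
(* The right branch encodes -1 - y^2; the truncated subtraction is exact because a remainder is at
   most p - 1. *)
pose f (z : 'I_h + 'I_h) : 'I_p :=
  match z with
  | inl x => Ordinal (ltn_pmod (x ^ 2) p_gt0)
  | inr y => Ordinal (ltn_pmod (p - 1 - y ^ 2 %% p) p_gt0)
  end.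
have sq_inj (x y : nat) : (2 * x < p)%N -> (2 * y < p)%N ->
    x ^ 2 = y ^ 2 %[mod p] -> x = y.
  wlog le_xy : x y / (x <= y)%N => [IH|] hx hy.
    by case: (leqP x y) => [/IH|/ltnW/IH] h1 /esym h2; [|symmetry]; apply: h1.
  move=> /esym/eqP; rewrite eqn_mod_dvd ?leq_sqr // subn_sqr Euclid_dvdM //.
  by case/orP=> [|] /dvdnP[k]; case: k => [|k]; nia.
have : ~ injective f.
  by move/leq_card; rewrite card_sum !card_ord /h; lia.
move=> f_not_inj.
have /injectivePn[z [z' zz' fzz']] : ~~ injectiveb f by apply/injectiveP.
have lt_half (x : 'I_h) : (2 * x < p)%N by have := ltn_ord x; rewrite /h; lia.
have mixed (x y : 'I_h) : f (inl x) = f (inr y) ->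
    exists x y : nat,
      [/\ (2 * x < p)%N, (2 * y < p)%N & (p %| x ^ 2 + y ^ 2 + 1)%N].
  move=> /(congr1 val) /= e; exists x, y; split=> //.
  have := ltn_pmod (y ^ 2) p_gt0 => r_lt.
  move: e; rewrite [RHS]modn_small; last by lia.
  move=> e; apply/dvdnP; exists (x ^ 2 %/ p + y ^ 2 %/ p + 1)%N.
  by rewrite {1}(divn_eq (x ^ 2) p) {1}(divn_eq (y ^ 2) p) e; lia.
case: z z' zz' fzz' => [x|y] [x'|y'] zz' fzz'.
- case/eqP: zz'; congr inl; apply: val_inj.
  exact: sq_inj (lt_half x) (lt_half x') (congr1 val fzz').
- exact: mixed fzz'.
- exact: mixed (esym fzz').
- case/eqP: zz'; congr inr; apply: val_inj.
  apply: sq_inj (lt_half y) (lt_half y') _.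
  have /= := congr1 val fzz'.
  have := ltn_pmod (y ^ 2) p_gt0; have := ltn_pmod (y' ^ 2) p_gt0.
  by move=> h1 h2; rewrite !(@modn_small (_ - _)); lia.
Qed.

Lemma centered_residue (m x : int) : 0 < m ->
  exists y k, [/\ x = y + m * k, - m < 2 * y & 2 * y <= m].
Proof.
move=> m_gt0; pose k := (x %/ m)%Z; pose y := (x %% m)%Z.
have def_x : x = k * m + y := divz_eq x m.
have y_ge0 : 0 <= y by apply: modz_ge0; lia.
have y_lt : y < m by apply: ltz_pmod.
have [le|gt] := lerP (2 * y) m; first by exists y, k; split; lia.
by exists (y - m), (k + 1); split; lia.
Qed.

Lemma centered_square_le (m y : int) : - m < 2 * y -> 2 * y <= m ->
  4 * y ^+ 2 <= m ^+ 2.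
Proof.
move=> lo hi; have : 0 <= (m - 2 * y) * (m + 2 * y) by apply: mulr_ge0; lia.
by lia.
Qed.

Lemma centered_square_eq (m y : int) : - m < 2 * y -> 2 * y <= m ->
  m ^+ 2 <= 4 * y ^+ 2 -> 2 * y = m.
Proof.
move=> lo hi le; have : (m - 2 * y) * (m + 2 * y) <= 0 by lia.
by rewrite pmulr_lle0; lia.
Qed.

(** Lagrange's descent in quaternions: for y the centered residue of x mod m, N(y) = mr with r at
    most m, and conj(x) y is divisible by m, so its quotient has norm rp. Either r = 0 or r = m
    would force m to divide p. *)
Lemma four_square_descent (p m : int) (x0 x1 x2 x3 : int) :
  0 < m -> ~~ (m %| p)%Z -> m * p = norm_form x0 x1 x2 x3 ->
  exists r z0 z1 z2 z3, [/\ 0 < r, r < m & r * p = norm_form z0 z1 z2 z3].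
Proof.
move=> m_gt0 m_ndvd.
have [y0 [k0 [-> lo0 hi0]]] := centered_residue x0 m_gt0.
have [y1 [k1 [-> lo1 hi1]]] := centered_residue x1 m_gt0.
have [y2 [k2 [-> lo2 hi2]]] := centered_residue x2 m_gt0.
have [y3 [k3 [-> lo3 hi3]]] := centered_residue x3 m_gt0.
rewrite /norm_form => E.
pose c := y0 * k0 + y1 * k1 + y2 * k2 + y3 * k3.
pose r := p - 2 * c - m * (k0 ^+ 2 + k1 ^+ 2 + k2 ^+ 2 + k3 ^+ 2).
have mr : m * r = y0 ^+ 2 + y1 ^+ 2 + y2 ^+ 2 + y3 ^+ 2.
  by rewrite /r !mulrBr E /c; ring.
have b0 := centered_square_le lo0 hi0; have b1 := centered_square_le lo1 hi1.
have b2 := centered_square_le lo2 hi2; have b3 := centered_square_le lo3 hi3.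
have r_ge0 : 0 <= r.
  rewrite -(pmulr_rge0 _ m_gt0) mr.
  by rewrite !addr_ge0 // sqr_ge0.
have r_le : r <= m by rewrite -(ler_pM2l m_gt0) mr; clear -b0 b1 b2 b3; lia.
have def_p : p = r + 2 * c + m * (k0 ^+ 2 + k1 ^+ 2 + k2 ^+ 2 + k3 ^+ 2).
  by rewrite /r; ring.
have r_neq0 : r != 0.
  apply: contra m_ndvd => /eqP r0; move: mr; rewrite r0 mulr0 => /esym y_eq0.
  have [y00 y10 y20 y30] : [/\ y0 = 0, y1 = 0, y2 = 0 & y3 = 0].
    have := (sqr_ge0 y0, sqr_ge0 y1, sqr_ge0 y2, sqr_ge0 y3) => -[[[h0 h1] h2] h3].
    by split; apply/eqP; rewrite -sqrf_eq0; apply/eqP; clear -y_eq0 h0 h1 h2 h3; lia.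
  by rewrite def_p r0 /c y00 y10 y20 y30 !(mul0r, mulr0, addr0, add0r) dvdz_mulr.
have r_neqm : r != m.
  (* All the residues are m/2, so the norm of y + mk is divisible by m^2. *)
  apply: contra m_ndvd => /eqP rm; move: mr; rewrite rm => y_eqm.
  have e0 : 2 * y0 = m by apply: centered_square_eq => //;
    clear -y_eqm b0 b1 b2 b3; lia.
  have e1 : 2 * y1 = m by apply: centered_square_eq => //;
    clear -y_eqm b0 b1 b2 b3; lia.
  have e2 : 2 * y2 = m by apply: centered_square_eq => //;
    clear -y_eqm b0 b1 b2 b3; lia.
  have e3 : 2 * y3 = m by apply: centered_square_eq => //;
    clear -y_eqm b0 b1 b2 b3; lia.
  have -> : p = m * (1 + k0 + k1 + k2 + k3 +
      (k0 ^+ 2 + k1 ^+ 2 + k2 ^+ 2 + k3 ^+ 2)).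
    by rewrite def_p rm /c 3!mulrDr !mulrA e0 e1 e2 e3; ring.
  exact: dvdz_mulr.
(* With x = y + mk, the witness is conj(x) y / m = r + conj(k) y, whose real part is r + c. *)
exists r, (r + c), (k0 * y1 - k1 * y0 + k3 * y2 - k2 * y3),
  (k0 * y2 - k2 * y0 + k1 * y3 - k3 * y1),
  (k0 * y3 - k3 * y0 + k2 * y1 - k1 * y2).
split; [by rewrite lt_def r_neq0 | by rewrite lt_def eq_sym r_neqm |].
(* Multiplied by m^2 the claim is N(y) N(x) = N(conj(x) y), where r and p occur only through mr and
   mp and can be eliminated. *)
apply: (@mulfI _ (m ^+ 2)); first by rewrite expf_eq0 gt_eqF.
have -> : m ^+ 2 * (r * p) = (m * r) * (m * p) by ring.
have scale z1 z2 z3 : m ^+ 2 * norm_form (r + c) z1 z2 z3 =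
    (m * r + m * c) ^+ 2 + m ^+ 2 * (z1 ^+ 2 + z2 ^+ 2 + z3 ^+ 2).
  by rewrite /norm_form; ring.
by rewrite scale mr E /c; ring.
Qed.

(** Start from mp = x^2 + y^2 + 1 + 0 with m < p, and descend to m = 1; primality of p gives the
    non-divisibility each descent requires. *)
Lemma prime_four_squares (p : nat) : prime p -> odd p ->
  exists t0 t1 t2 t3, p%:Z = norm_form t0 t1 t2 t3.
Proof.
move=> p_pr p_odd.
have [x [y [hx hy /dvdnP[m Em]]]] := dvdn_square_sum_succ p_pr p_odd.
have m_gt0 : (0 < m)%N by case: m Em => //; lia.
have m_lt : (m < p)%N.
  have p_gt1 := prime_gt1 p_pr.
  rewrite -(ltn_pmul2r (prime_gt0 p_pr)) -Em -!mulnn.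
  by have := (ltn_mul hx hx, ltn_mul hy hy, leq_mul p_gt1 p_gt1) => -[[]]; lia.
have {Em hx hy} : exists x0 x1 x2 x3, m%:Z * p%:Z = norm_form x0 x1 x2 x3.
  exists x, y, 1, 0; clear -Em; move: Em.
  by rewrite /norm_form !expr2 -!mulnn; lia.
elim/ltn_ind: m m_gt0 m_lt => m IHm m_gt0 m_lt [x0 [x1 [x2 [x3 E]]]].
have [m1|m_neq1] := eqVneq m 1%N.
  by exists x0, x1, x2, x3; rewrite -E m1 mul1r.
have m_ndvd : ~~ (m %| p)%N.
  by apply/negP=> /(prime_nt_dvdP p_pr m_neq1) mp; rewrite mp ltnn in m_lt.
have [|r [z0 [z1 [z2 [z3 [r_gt0 r_lt Er]]]]]] := @four_square_descent p m _ _ _ _ _ m_ndvd E.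
  by [].
by apply: (IHm `|r|%N); try lia; exists z0, z1, z2, z3; rewrite -Er; lia.
Qed.

(** * Central extensions of the Klein four-group *)

Definition det3 (R : comNzRingType) (F : nat -> nat -> R) : R :=
  F 0%N 0%N * (F 1%N 1%N * F 2%N 2%N - F 1%N 2%N * F 2%N 1%N)
  - F 0%N 1%N * (F 1%N 0%N * F 2%N 2%N - F 1%N 2%N * F 2%N 0%N)
  + F 0%N 2%N * (F 1%N 0%N * F 2%N 1%N - F 1%N 1%N * F 2%N 0%N).

Lemma det_mx33 (R : comNzRingType) (F : nat -> nat -> R) :
  \det (\matrix_(i < 3, j < 3) F i j) = det3 F.
Proof.
do 2!rewrite !(expand_det_row _ ord0) !big_ord_recl !big_ord0 /cofactor.
by rewrite !det_mx11 !mxE /det3 /=; ring.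
Qed.

(** Laplace expansion along the first row; [bump k] skips column k. Natural number indices let
    concrete entries compute before [ring]. *)
Definition det4 (R : comNzRingType) (F : nat -> nat -> R) : R :=
  let minor k := det3 (fun i j => F i.+1 (bump k j)) in
  F 0%N 0%N * minor 0%N - F 0%N 1%N * minor 1%N
  + F 0%N 2%N * minor 2%N - F 0%N 3%N * minor 3%N.

Lemma det_mx44 (R : comNzRingType) (F : nat -> nat -> R) :
  \det (\matrix_(i < 4, j < 4) F i j) = det4 F.
Proof.
rewrite (expand_det_row _ ord0) !big_ord_recl !big_ord0 /cofactor.
have minorE (k : 'I_4) :
    \det (row' ord0 (col' k (\matrix_(i < 4, j < 4) F i j))) =
    det3 (fun i j => F i.+1 (bump k j)).
  by rewrite -det_mx33; congr (\det _); apply/matrixP => i j; rewrite !mxE.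
by rewrite !minorE !mxE /det4 /= /bump /= !(add0n, addn0, addn1, add1n); ring.
Qed.

(** Bitwise exclusive or on 0, ..., 3. *)
Definition klein_add (i j : nat) : nat :=
  nth 0%N (nth [::] [:: [:: 0; 1; 2; 3]; [:: 1; 0; 3; 2];
                        [:: 2; 3; 0; 1]; [:: 3; 2; 1; 0]] i)%N j.

(** This is P - Q when c is the cocycle of the extension, and P + Q when c is trivial. *)
Definition twisted_klein_mx (c : nat -> nat -> bool) (t : nat -> int) : 'M_4 :=
  \matrix_(i < 4, j < 4) ((-1) ^+ c i j * t (klein_add i j)).

Lemma det_untwisted_klein_mx (s : nat -> int) :
  \det (twisted_klein_mx (fun _ _ => false) s) =
  klein_form (s 0%N) (s 1%N) (s 2%N) (s 3%N).
Proof.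
rewrite (det_mx44 (fun i j => (-1) ^+ false * s (klein_add i j))).
by rewrite /det4 /det3 /bump /klein_add /klein_form /=; ring.
Qed.

(* The conditions s_i = t_i mod 2 make s_i = x(r_i) + x(z r_i) and
   t_i = x(r_i) - x(z r_i) solvable for x. *)
Definition paired_values (E : int -> int -> int -> int -> int) (D : int) : Prop :=
  exists s0 s1 s2 s3 t0 t1 t2 t3,
    [/\ (s0 = t0 %[mod 2])%Z, (s1 = t1 %[mod 2])%Z, (s2 = t2 %[mod 2])%Z,
        (s3 = t3 %[mod 2])%Z & D = klein_form s0 s1 s2 s3 * E t0 t1 t2 t3].

(* The table hypothesis is r_i r_j^-1 = z^c(i,j) r_(i+j): modulo z the r_i form
   a Klein four-group, with cocycle c. *)
Lemma int_group_dets_klein_extension (gT : finGroupType) (z : gT)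
    (r : nat -> gT) (c : nat -> nat -> bool) (E : int -> int -> int -> int -> int) :
  #|gT| = 8%N -> (z * z = 1)%g ->
  (forall i, (i < 4)%N -> commute z (r i)) ->
  (forall i j, (i < 4)%N -> (j < 4)%N ->
     r i = (z ^+ c i j * r (klein_add i j) * r j)%g) ->
  (forall g, exists (b : bool) i, (i < 4)%N /\ g = (z ^+ b * r i)%g) ->
  (forall t, \det (twisted_klein_mx c t) = E (t 0%N) (t 1%N) (t 2%N) (t 3%N)) ->
  forall D, int_group_dets gT D <-> paired_values E D.
Proof.
move=> card_gT zz comm_zr table surj det_c D.
pose f (i : 'I_(4 + 4)) :=
  match fintype.split i with inl j => r j | inr j => (z * r j)%g end.
have f_surj g : exists i, f i = g.
  have [b [i [i_lt ->]]] := surj g.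
  case: b; [exists (rshift 4 (Ordinal i_lt)) | exists (lshift 4 (Ordinal i_lt))].
    by rewrite /f (unsplitK (inr _)) expg1.
  by rewrite /f (unsplitK (inl _)) expg0 mul1g.
have f_bij : bijective f.
  apply: inj_card_bij; last by rewrite card_gT card_ord.
  apply/injectiveP; rewrite /injectiveb /dinjectiveb -/(codom f).
  apply/card_uniqP; rewrite size_codom card_ord; apply: etrans card_gT.
  by apply: eq_card => g; have [i <-] := f_surj g; rewrite codom_f.
have z_inv : (z^-1 = z)%g by apply/eqP; rewrite eq_invg_mul zz.
have quot i j : (i < 4)%N -> (j < 4)%N ->
    (r i * (r j)^-1 = z ^+ c i j * r (klein_add i j))%g.
  by move=> hi hj; rewrite (table i j hi hj) mulgK.
have det_f (x : gT -> int) : group_det x =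
    \det (twisted_klein_mx (fun _ _ => false) (fun k => x (r k) + x (z * r k)%g)) *
    \det (twisted_klein_mx c (fun k => x (r k) - x (z * r k)%g)).
  rewrite (group_det_reindex x f_bij).
  pose P := \matrix_(i < 4, j < 4) x (r i * (r j)^-1)%g.
  pose Q := \matrix_(i < 4, j < 4) x (z * (r i * (r j)^-1))%g.
  have -> : \matrix_(i < 4 + 4, j < 4 + 4) x (f i * (f j)^-1)%g = block_mx P Q Q P.
    have zc k (k_lt : (k < 4)%N) : commute z (r k)^-1.
      by apply: commuteV; apply: comm_zr.
    apply/matrixP=> i j; rewrite !mxE /f.
    case: (fintype.split i) => a; rewrite !mxE; case: (fintype.split j) => b; rewrite !mxE //.
    - by rewrite invMg z_inv -(zc b) // !mulgA -(comm_zr a).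
    - by rewrite mulgA.
    - by rewrite invMg z_inv -(zc b) // !mulgA -(mulgA z) -(comm_zr a) // mulgA zz mul1g.
  rewrite det_block_circulant; congr (_ * _); congr (\det _);
    apply/matrixP=> i j; rewrite !mxE quot //; case: (c i j);
    by rewrite ?expg1 ?expg0 ?mul1g ?mulgA ?zz ?mul1g; ring.
split=> [[x _ <-]|].
  rewrite det_f det_untwisted_klein_mx det_c.
  pose s k := x (r k) + x (z * r k)%g; pose t k := x (r k) - x (z * r k)%g.
  exists (s 0%N), (s 1%N), (s 2%N), (s 3%N), (t 0%N), (t 1%N), (t 2%N), (t 3%N).
  by split; rewrite // /s /t; lia.
move=> [s0 [s1 [s2 [s3 [t0 [t1 [t2 [t3 [e0 e1 e2 e3 ->]]]]]]]]].
have [g fg gf] := f_bij.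
pose X h := match fintype.split (g h) with
  | inl k => nth 0 [:: (s0 + t0) %/ 2; (s1 + t1) %/ 2; (s2 + t2) %/ 2; (s3 + t3) %/ 2]%Z k
  | inr k => nth 0 [:: (s0 - t0) %/ 2; (s1 - t1) %/ 2; (s2 - t2) %/ 2; (s3 - t3) %/ 2]%Z k
  end.
have Xr k : (k < 4)%N -> X (r k) =
    nth 0 [:: (s0 + t0) %/ 2; (s1 + t1) %/ 2; (s2 + t2) %/ 2; (s3 + t3) %/ 2]%Z k.
  move=> hk; have -> : r k = f (lshift 4 (Ordinal hk)).
    by rewrite /f (unsplitK (inl _)).
  by rewrite /X fg (unsplitK (inl _)).
have Xzr k : (k < 4)%N -> X (z * r k)%g =
    nth 0 [:: (s0 - t0) %/ 2; (s1 - t1) %/ 2; (s2 - t2) %/ 2; (s3 - t3) %/ 2]%Z k.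
  move=> hk; have -> : (z * r k)%g = f (rshift 4 (Ordinal hk)).
    by rewrite /f (unsplitK (inr _)).
  by rewrite /X fg (unsplitK (inr _)).
exists X => //; rewrite det_f det_untwisted_klein_mx det_c !Xr // !Xzr //=.
by congr (klein_form _ _ _ _ * E _ _ _ _); lia.
Qed.

Lemma int_group_dets_Z2Z2Z2 (D : int) :
  int_group_dets ('Z_2 * 'Z_2 * 'Z_2)%type D <->
  paired_values klein_form D.
Proof.
pose gT : finGroupType := ('Z_2 * 'Z_2 * 'Z_2)%type.
pose r : nat -> gT := nth (0, 0, 0)
  [:: (0, 0, 0); (0, 1, 0); (0, 0, 1); (0, 1, 1)].
pose z : gT := (1, 0, 0).
(* Here z generates a direct factor with complement the r_i, so the cocycle is trivial. *)
apply: (@int_group_dets_klein_extension gT z r (fun _ _ => false)).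
- by rewrite !card_prod !card_ord.
- by apply/eqP.
- by case=> [|[|[|[|]]]] // _; apply/eqP.
- by case=> [|[|[|[|]]]] //; case=> [|[|[|[|]]]] // _ _; apply/eqP.
- move=> [[[i1 h1] [i2 h2]] [i3 h3]].
  case: i1 h1 => [|[|]] // h1; case: i2 h2 => [|[|]] // h2;
    case: i3 h3 => [|[|]] // h3.
  + by exists false, 0%N; split=> //; apply/eqP.
  + by exists false, 2%N; split=> //; apply/eqP.
  + by exists false, 1%N; split=> //; apply/eqP.
  + by exists false, 3%N; split=> //; apply/eqP.
  + by exists true, 0%N; split=> //; apply/eqP.
  + by exists true, 2%N; split=> //; apply/eqP.
  + by exists true, 1%N; split=> //; apply/eqP.
  + by exists true, 3%N; split=> //; apply/eqP.
- exact: det_untwisted_klein_mx.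
Qed.

Lemma int_group_dets_Z4Z2 (D : int) :
  int_group_dets ('Z_4 * 'Z_2)%type D <->
  paired_values gauss_form D.
Proof.
pose gT : finGroupType := ('Z_4 * 'Z_2)%type.
pose r : nat -> gT := nth (0, 0) [:: (0, 0); (1, 0); (0, 1); (1, 1)].
pose z : gT := (2, 0).
(* The Z_4 component of r_i is the low bit of i; a factor z appears exactly when 0 - 1 = 3 = 2 + 1
   is formed there. *)
pose c i j := ~~ odd i && odd j.
have det_c (t : nat -> int) :
    \det (twisted_klein_mx c t) = gauss_form (t 0%N) (t 1%N) (t 2%N) (t 3%N).
  rewrite (det_mx44 (fun i j => (-1) ^+ c i j * t (klein_add i j))).
  by rewrite /det4 /det3 /bump /klein_add /gauss_form /c /=; ring.
apply: (@int_group_dets_klein_extension gT z r c) => //.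
- by rewrite !card_prod !card_ord.
- by apply/eqP.
- by case=> [|[|[|[|]]]] // _; apply/eqP.
- by case=> [|[|[|[|]]]] //; case=> [|[|[|[|]]]] // _ _; apply/eqP.
- move=> [[i1 h1] [i2 h2]].
  case: i1 h1 => [|[|[|[|]]]] // h1; case: i2 h2 => [|[|]] // h2.
  + by exists false, 0%N; split=> //; apply/eqP.
  + by exists false, 2%N; split=> //; apply/eqP.
  + by exists false, 1%N; split=> //; apply/eqP.
  + by exists false, 3%N; split=> //; apply/eqP.
  + by exists true, 0%N; split=> //; apply/eqP.
  + by exists true, 2%N; split=> //; apply/eqP.
  + by exists true, 1%N; split=> //; apply/eqP.
  + by exists true, 3%N; split=> //; apply/eqP.
Qed.

Lemma Q8_generators : exists a b : 'Q_8,
  [/\ (<[a]> <*> <[b]>)%g = [set: 'Q_8], (a ^+ 4 = 1)%g, (b ^+ 2 = a ^+ 2)%g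
    & (a * b = b * a^-1)%g].
Proof.
have /existsP[[a b] /=] : ([set: 'Q_8] \homg
    Grp (a : b : (a ^+ 4, b ^+ 2 = a ^+ 2, a * b = b * a^-1)))%g.
  by rewrite -Q8_presentation homg_refl.
rewrite !xpair_eqE.
by case/and4P => /eqP gen /eqP a4 /eqP b2 /eqP ab; exists a, b.
Qed.

Lemma int_group_dets_Q8 (D : int) :
  int_group_dets 'Q_8 D <->
  paired_values (fun t0 t1 t2 t3 => norm_form t0 t1 t2 t3 ^+ 2) D.
Proof.
have [a [b [gen a4 b2 ab]]] := Q8_generators.
pose z := (a * a)%g; pose r := nth 1%g [:: 1; a; b; a * b]%g.
have aa : (a * a = z)%g by [].
have bb : (b * b = z)%g := b2.
have zz : (z * z = 1)%g by rewrite -[RHS]a4 !expgS expg0 mulg1 /z !mulgA.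
have za : commute z a by rewrite /commute /z mulgA.
have zb : commute z b by rewrite /commute -bb mulgA.
have ba : (b * a = z * (a * b))%g.
  have za_inv : (z * a = a^-1)%g by apply/eqP; rewrite eq_mulgV1 invgK -mulgA zz.
  by rewrite mulgA za_inv; apply: (mulgI a); rewrite mulgA ab mulgKV mulKVg.
clearbody z.
(* The signs of e_i / e_j for the quaternion units 1, i, j, k, played by 1, a, b, ab. *)
pose c i j := nth false (nth [::]
  [:: [:: false; true; true; true]; [:: false; false; true; false];
      [:: false; false; false; true]; [:: false; true; false; false]] i) j.
have det_c (t : nat -> int) :
    \det (twisted_klein_mx c t) = norm_form (t 0%N) (t 1%N) (t 2%N) (t 3%N) ^+ 2.
  rewrite (det_mx44 (fun i j => (-1) ^+ c i j * t (klein_add i j))).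
  by rewrite /det4 /det3 /bump /klein_add /norm_form /c /=; ring.
apply: (@int_group_dets_klein_extension _ z r c) => //.
- by rewrite -cardsT (@card_quaternion 3 isT).
- case=> [|[|[|[|]]]] // _; rewrite /r /=; first exact: commute1.
  exact: commuteM.
(* These rules move z to the front and a before b, reaching a normal form. *)
- have zK (g : 'Q_8) : (z * (z * g) = g)%g by rewrite mulgA zz mul1g.
  have aaM (g : 'Q_8) : (a * (a * g) = z * g)%g by rewrite mulgA aa.
  have bbM (g : 'Q_8) : (b * (b * g) = z * g)%g by rewrite mulgA bb.
  have baM (g : 'Q_8) : (b * (a * g) = z * (a * (b * g)))%g by rewrite mulgA ba -!mulgA.
  have azM (g : 'Q_8) : (a * (z * g) = z * (a * g))%g by rewrite !mulgA za.
  have bzM (g : 'Q_8) : (b * (z * g) = z * (b * g))%g by rewrite !mulgA zb.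
  have az : (a * z = z * a)%g := esym za.
  have bz : (b * z = z * b)%g := esym zb.
  case=> [|[|[|[|]]]] //; case=> [|[|[|[|]]]] // _ _; rewrite /r /c /klein_add /=;
    rewrite ?expg0 ?expg1 ?mul1g ?mulg1 -?mulgA //;
    by rewrite !(aaM, bbM, baM, aa, bb, ba, azM, bzM, az, bz, zK, zz, mulg1).
(* Every element is a^i b^j up to order of factors; since a and b square to z, both exponents reduce
   mod 2 at the cost of powers of z. *)
- have power u (n : nat) : (u * u = z)%g ->
      exists c e : bool, (u ^+ n = z ^+ c * u ^+ e)%g.
    move=> uu; exists (odd n./2), (odd n).
    rewrite -[in LHS](odd_double_half n) addnC expgD -mul2n expgM expgS expg1 uu.
    by rewrite -!modn2 (expg_mod _ (zz : z ^+ 2 = 1)%g).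
  move=> g; have : g \in (<[a]> <*> <[b]>)%g by rewrite gen inE.
  rewrite norm_joinEr; last first.
    rewrite cycle_subG inE -cycleJ cycle_subG /= conjgE.
    by rewrite ab mulKg groupV cycle_id.
  case/mulsgP => _ _ /cycleP[i ->] /cycleP[j ->] ->.
  have [c1 [e1 ->]] := power a i aa; have [c2 [e2 ->]] := power b j bb.
  (* The list r is indexed in binary: the low bit is the exponent of a, the high bit that of b. *)
  exists (c1 (+) c2), (e1 + 2 * e2)%N; split; first by case: e1 e2 => [] [].
  have -> : (z ^+ (c1 (+) c2) = z ^+ c1 * z ^+ c2)%g.
    by case: c1 c2 => [] []; rewrite ?expg0 ?expg1 ?mulg1 ?mul1g ?zz.
  rewrite -!mulgA; congr (_ * _)%g; rewrite !mulgA.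
  have -> : (a ^+ e1 * z ^+ c2 = z ^+ c2 * a ^+ e1)%g.
    by apply/esym; apply: commuteX2.
  by rewrite -mulgA; congr (_ * _)%g; case: e1 e2 => [] []; rewrite ?mulg1 ?mul1g.
Qed.

(** * Values of the group determinants *)

Lemma odd_mul_mod8 (a b : int) : (a %% 2)%Z = 1 -> (a %% 8)%Z = (b %% 8)%Z ->
  ((a * b) %% 8)%Z = 1.
Proof.
move=> a_odd ab; have := odd_square_mod8 a_odd.
have [j ->] : exists j, b = a + 8 * j by exists ((b - a) %/ 8)%Z; lia.
by clear; lia.
Qed.

(** The cases are an odd number of odd entries, exactly two, and none or all. *)
Lemma parity_cases (s0 s1 s2 s3 : int) :
  [\/ ((s0 + s1 + s2 + s3) %% 2)%Z = 1,
      ((s0 + s1 + s2 + s3) %% 2)%Z = 0 /\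
        [|| (s1 != s0 %[mod 2])%Z, (s2 != s0 %[mod 2])%Z | (s3 != s0 %[mod 2])%Z]
    | exists b : bool, [/\ (s0 %% 2)%Z = b, (s1 %% 2)%Z = b, (s2 %% 2)%Z = b
        & (s3 %% 2)%Z = b]].
Proof.
have [h|h] : ((s0 + s1 + s2 + s3) %% 2)%Z = 1 \/
    ((s0 + s1 + s2 + s3) %% 2)%Z = 0 by lia.
  by constructor 1.
have [mixed|same] := boolP [|| (s1 != s0 %[mod 2])%Z, (s2 != s0 %[mod 2])%Z
  | (s3 != s0 %[mod 2])%Z]; first by constructor 2.
by constructor 3; exists ((s0 %% 2)%Z == 1); split; lia.
Qed.

Lemma klein_form_same (b : bool) s0 s1 s2 s3 :
  (s0 %% 2)%Z = b -> (s1 %% 2)%Z = b -> (s2 %% 2)%Z = b -> (s3 %% 2)%Z = b ->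
  (klein_form s0 s1 s2 s3 %% 64)%Z = 16 + 32 * b%:Z \/
  (256 %| klein_form s0 s1 s2 s3)%Z.
Proof.
move=> h0 h1 h2 h3.
have E x : (x %% 2)%Z = b -> x = 2 * (x %/ 2)%Z + b by lia.
rewrite (E _ h0) (E _ h1) (E _ h2) (E _ h3); case: b {h0 h1 h2 h3 E}.
  exact: klein_form_all_odd.
by rewrite !addr0; apply: klein_form_double.
Qed.

Lemma gauss_form_same (b : bool) t0 t1 t2 t3 :
  (t0 %% 2)%Z = b -> (t1 %% 2)%Z = b -> (t2 %% 2)%Z = b -> (t3 %% 2)%Z = b ->
  (16 %| gauss_form t0 t1 t2 t3)%Z.
Proof.
move=> h0 h1 h2 h3.
have E x : (x %% 2)%Z = b -> x = 2 * (x %/ 2)%Z + b by lia.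
rewrite (E _ h0) (E _ h1) (E _ h2) (E _ h3).
set u0 := (t0 %/ 2)%Z; set u1 := (t1 %/ 2)%Z; set u2 := (t2 %/ 2)%Z.
set u3 := (t3 %/ 2)%Z.
have -> : gauss_form (2 * u0 + b) (2 * u1 + b) (2 * u2 + b) (2 * u3 + b) =
    16 * (((u0 + u2 + b) ^+ 2 + (u1 + u3 + b) ^+ 2) *
          ((u0 - u2) ^+ 2 + (u1 - u3) ^+ 2)).
  by rewrite /gauss_form; ring.
exact: dvdz_mulr.
Qed.

Lemma klein_gauss_values s0 s1 s2 s3 t0 t1 t2 t3 :
  (s0 = t0 %[mod 2])%Z -> (s1 = t1 %[mod 2])%Z ->
  (s2 = t2 %[mod 2])%Z -> (s3 = t3 %[mod 2])%Z ->
  ((klein_form s0 s1 s2 s3 * gauss_form t0 t1 t2 t3) %% 8)%Z = 1 \/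
  (256 %| klein_form s0 s1 s2 s3 * gauss_form t0 t1 t2 t3)%Z.
Proof.
move=> e0 e1 e2 e3; case: (parity_cases s0 s1 s2 s3) => [hs|[hs mixed]|[b [h0 h1 h2 h3]]].
- left; have ht : ((t0 + t1 + t2 + t3) %% 2)%Z = 1 by lia.
  have ks := klein_form_odd hs; apply: odd_mul_mod8; first by lia.
  by rewrite ks (gauss_form_odd ht) e0 e1 e2 e3.
- right; have ht : ((t0 + t1 + t2 + t3) %% 2)%Z = 0 by lia.
  by apply: (@dvdz_mul 64 4); [exact: klein_form_mixed | exact: gauss_form_even].
- right; apply: (@dvdz_mul 16 16); first by have := klein_form_same h0 h1 h2 h3; lia.
  by apply: (@gauss_form_same b); lia.
Qed.

Lemma klein_norm_values s0 s1 s2 s3 t0 t1 t2 t3 :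
  (s0 = t0 %[mod 2])%Z -> (s1 = t1 %[mod 2])%Z ->
  (s2 = t2 %[mod 2])%Z -> (s3 = t3 %[mod 2])%Z ->
  let D := klein_form s0 s1 s2 s3 * norm_form t0 t1 t2 t3 ^+ 2 in
  [\/ (D %% 8)%Z = 1, (256 %| D)%Z
    | exists (m : int) (p : nat),
        [/\ prime p, p = 3 %[mod 4] & D = (8 * m - 3) * p%:Z ^+ 2]].
Proof.
move=> e0 e1 e2 e3 D; have N4 := norm_form_mod4 t0 t1 t2 t3.
case: (parity_cases s0 s1 s2 s3) => [hs|[hs mixed]|[b [h0 h1 h2 h3]]].
- have k8 := klein_form_odd hs.
  have N_odd : (norm_form t0 t1 t2 t3 %% 2)%Z = 1 by lia.
  have [N1|N3] : (norm_form t0 t1 t2 t3 %% 4)%Z = 1 \/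
      (norm_form t0 t1 t2 t3 %% 4)%Z = 3 by lia.
    constructor 1; apply: odd_mul_mod8; first by lia.
    by rewrite (odd_square_mod8 N_odd); lia.
  constructor 3; have N_ge0 : 0 <= norm_form t0 t1 t2 t3.
    by rewrite !addr_ge0 // sqr_ge0.
  have k5 : (klein_form s0 s1 s2 s3 %% 8)%Z = 5 by lia.
  rewrite /D -(gez0_abs N_ge0).
  have [|p [p_pr p3 /dvdnP[k Nk]]] := @prime_factor_3mod4 `|norm_form t0 t1 t2 t3|.
    by move: (norm_form _ _ _ _) N3 N_ge0; clear; lia.
  (* With N = kp and k odd, the Klein form times k^2 is 5 = -3 mod 8, hence of the form 8m - 3. *)
  exists ((klein_form s0 s1 s2 s3 * k%:Z ^+ 2 + 3) %/ 8)%Z, p; split=> //.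
  have k_odd : (k%:Z %% 2)%Z = 1.
    have : odd (k * p) by rewrite -Nk; lia.
    by rewrite oddM => /andP[]; lia.
  have := odd_square_mod8 k_odd.
  rewrite Nk PoszM exprMn mulrA; set K := k%:Z ^+ 2 => K8; congr (_ * _).
  have [u ->] : exists u, K = 8 * u + 1 by exists (K %/ 8)%Z; lia.
  have [v ->] : exists v, klein_form s0 s1 s2 s3 = 8 * v + 5.
    by exists (klein_form s0 s1 s2 s3 %/ 8)%Z; lia.
  by clear; lia.
- constructor 2; apply: (@dvdz_mul 64 4); first exact: klein_form_mixed.
  by rewrite expr2; apply: (@dvdz_mul 2 2); lia.
- constructor 2; apply: (@dvdz_mul 16 16); first by have := klein_form_same h0 h1 h2 h3; lia.
  by rewrite expr2; apply: (@dvdz_mul 4 4); lia.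
Qed.

Lemma klein_klein_values s0 s1 s2 s3 t0 t1 t2 t3 :
  (s0 = t0 %[mod 2])%Z -> (s1 = t1 %[mod 2])%Z ->
  (s2 = t2 %[mod 2])%Z -> (s3 = t3 %[mod 2])%Z ->
  let D := klein_form s0 s1 s2 s3 * klein_form t0 t1 t2 t3 in
  [\/ (D %% 8)%Z = 1, (D %% 1024)%Z = 256 | (4096 %| D)%Z].
Proof.
move=> e0 e1 e2 e3 D; rewrite /D.
case: (parity_cases s0 s1 s2 s3) => [hs|[hs mixed]|[b [h0 h1 h2 h3]]].
- constructor 1; have ht : ((t0 + t1 + t2 + t3) %% 2)%Z = 1 by lia.
  have ks := klein_form_odd hs; apply: odd_mul_mod8; first by lia.
  by rewrite ks (klein_form_odd ht) e0 e1 e2 e3.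
- constructor 3; apply: (@dvdz_mul 64 64); apply: klein_form_mixed => //; lia.
- have := klein_form_same h0 h1 h2 h3.
  have : (klein_form t0 t1 t2 t3 %% 64)%Z = 16 + 32 * b%:Z \/
      (256 %| klein_form t0 t1 t2 t3)%Z by apply: klein_form_same; lia.
  move: (klein_form s0 _ _ _) (klein_form t0 _ _ _) => K L.
  clear; case=> hL [] hK.
  (* Both factors have the same residue 16(1 + 2b) mod 64, and 256(1 + 2b)^2 is 256 mod 1024 for
     either b. *)
  + constructor 2.
    have [u ->] : exists u, K = 64 * u + 16 + 32 * b%:Z by exists (K %/ 64)%Z; lia.
    have [v ->] : exists v, L = 64 * v + 16 + 32 * b%:Z by exists (L %/ 64)%Z; lia.
    by case: b {hL hK}; lia.
  + by constructor 3; apply: (@dvdz_mul 256 16); lia.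
  + by constructor 3; apply: (@dvdz_mul 16 256); lia.
  + by constructor 3; apply: (@dvdz_mul 256 16); lia.
Qed.

(** The chosen s_i make the four Klein factors 8k + 1, 1, 1, 1. *)
Lemma paired_values_1mod8 E D : E 1 0 0 0 = 1 -> (D %% 8)%Z = 1 ->
  paired_values E D.
Proof.
move=> E1 D1; pose k := (D %/ 8)%Z.
exists (2 * k + 1), (2 * k), (2 * k), (2 * k), 1, 0, 0, 0; split; try lia.
by rewrite E1 mulr1 [LHS](divz_eq D 8) D1 -/k /klein_form; ring.
Qed.

(** The factors are 4m, 4, 2, 2; this attains every multiple allowed by [klein_form_mixed]. *)
Lemma klein_form_64 (m : int) : klein_form (m + 2) m (m - 1) (m - 1) = 64 * m.
Proof. by rewrite /klein_form; ring. Qed.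

(** In (m + 2, m, m - 1, m - 1) the odd pair is the first or the last according to the parity of m,
    so E must take the value c on both patterns. *)
Lemma paired_values_64 E (c m : int) (a0 a1 a2 a3 b0 b1 b2 b3 : int) :
  E (2 * a0) (2 * a1) (2 * a2 + 1) (2 * a3 + 1) = c ->
  E (2 * b0 + 1) (2 * b1 + 1) (2 * b2) (2 * b3) = c ->
  paired_values E (64 * m * c).
Proof.
move=> Ea Eb; have [k [[] def_m]] := int_parityE m; rewrite -klein_form_64.
- exists (m + 2), m, (m - 1), (m - 1), (2 * b0 + 1), (2 * b1 + 1), (2 * b2), (2 * b3).
  by rewrite Eb; split=> //; lia.
- exists (m + 2), m, (m - 1), (m - 1), (2 * a0), (2 * a1), (2 * a2 + 1), (2 * a3 + 1).
  by rewrite Ea; split=> //; lia.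
Qed.

Lemma paired_values_256 E D :
  E 0 0 1 1 = 4 -> E 1 1 0 0 = 4 -> (256 %| D)%Z -> paired_values E D.
Proof.
move=> Ea Eb /dvdzP[m ->]; have -> : m * 256 = 64 * m * 4 by ring.
exact: (@paired_values_64 E 4 m 0 0 0 0 0 0 0 0).
Qed.

Lemma int_group_dets_Z4Z2P D : int_group_dets ('Z_4 * 'Z_2)%type D <->
  (D %% 8)%Z = 1 \/ (256 %| D)%Z.
Proof.
rewrite int_group_dets_Z4Z2; split=> [|[D1|D0]].
- move=> [s0 [s1 [s2 [s3 [t0 [t1 [t2 [t3 [e0 e1 e2 e3 ->]]]]]]]]].
  exact: klein_gauss_values.
- exact: paired_values_1mod8.
- exact: paired_values_256.
Qed.

(** A norm that is 3 mod 4 has exactly three odd terms; permuting them puts the even one first, to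
    match the s_i chosen for Q_8. *)
Lemma norm_form_3odd (p : nat) : prime p -> p = 3 %[mod 4] ->
  exists t0 t1 t2 t3, [/\ (t0 %% 2)%Z = 0, (t1 %% 2)%Z = 1, (t2 %% 2)%Z = 1,
    (t3 %% 2)%Z = 1 & norm_form t0 t1 t2 t3 = p%:Z].
Proof.
move=> p_pr p3; have p_odd : odd p by lia.
have [t0 [t1 [t2 [t3 E]]]] := prime_four_squares p_pr p_odd.
have := norm_form_mod4 t0 t1 t2 t3; rewrite -E => N4.
have : [\/ (t0 %% 2)%Z = 0 /\ [/\ (t1 %% 2)%Z = 1, (t2 %% 2)%Z = 1 & (t3 %% 2)%Z = 1],
           (t1 %% 2)%Z = 0 /\ [/\ (t0 %% 2)%Z = 1, (t2 %% 2)%Z = 1 & (t3 %% 2)%Z = 1],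
           (t2 %% 2)%Z = 0 /\ [/\ (t0 %% 2)%Z = 1, (t1 %% 2)%Z = 1 & (t3 %% 2)%Z = 1] |
           (t3 %% 2)%Z = 0 /\ [/\ (t0 %% 2)%Z = 1, (t1 %% 2)%Z = 1 & (t2 %% 2)%Z = 1]].
  have [k0 [[] E0]] := int_parityE t0; have [k1 [[] E1]] := int_parityE t1;
  have [k2 [[] E2]] := int_parityE t2; have [k3 [[] E3]] := int_parityE t3;
  first [ exfalso; clear E; lia
        | clear E; constructor 1; do !split; lia
        | clear E; constructor 2; do !split; lia
        | clear E; constructor 3; do !split; lia
        | clear E; constructor 4; do !split; lia ].
case=> -[? [? ? ?]].
- by exists t0, t1, t2, t3.
- by exists t1, t0, t2, t3; split=> //; rewrite E /norm_form; ring.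
- by exists t2, t0, t1, t3; split=> //; rewrite E /norm_form; ring.
- by exists t3, t0, t1, t2; split=> //; rewrite E /norm_form; ring.
Qed.

Lemma int_group_dets_Q8P D : int_group_dets 'Q_8 D <->
  [\/ (D %% 8)%Z = 1, (256 %| D)%Z
    | exists (m : int) (p : nat),
        [/\ prime p, p = 3 %[mod 4] & D = (8 * m - 3) * p%:Z ^+ 2]].
Proof.
rewrite int_group_dets_Q8; split=> [|[D1|D0|[m [p [p_pr p3 ->]]]]].
- move=> [s0 [s1 [s2 [s3 [t0 [t1 [t2 [t3 [e0 e1 e2 e3 ->]]]]]]]]].
  exact: klein_norm_values.
- exact: paired_values_1mod8.
- exact: paired_values_256.
- have [t0 [t1 [t2 [t3 [h0 h1 h2 h3 <-]]]]] := norm_form_3odd p_pr p3.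
  (* The Klein factors are 8m - 3, 1, 1, 1. *)
  exists (2 * m), (2 * m - 1), (2 * m - 1), (2 * m - 1), t0, t1, t2, t3.
  by split; try lia; congr (_ * _); rewrite /klein_form; ring.
Qed.

Lemma int_group_dets_Z2Z2Z2P D : int_group_dets ('Z_2 * 'Z_2 * 'Z_2)%type D <->
  [\/ (D %% 8)%Z = 1, (D %% 1024)%Z = 256 | (4096 %| D)%Z].
Proof.
rewrite int_group_dets_Z2Z2Z2; split=> [|[D1|D256|D0]].
- move=> [s0 [s1 [s2 [s3 [t0 [t1 [t2 [t3 [e0 e1 e2 e3 ->]]]]]]]]].
  exact: klein_klein_values.
- exact: paired_values_1mod8.
- pose m := (D %/ 1024)%Z.
  (* The Klein forms are (8m + 2) * 8 and 16, with product 1024m + 256. *)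
  exists (2 * m + 2), (2 * m), (2 * m), (2 * m), 2, 0, 0, 0; split; try lia.
  by rewrite [LHS](divz_eq D 1024) D256 -/m /klein_form; ring.
- case/dvdzP: D0 => m ->; have -> : m * 4096 = 64 * m * 64 by ring.
  (* The vectors are (0, 0, 3, 1) and (3, 1, 0, 0), both of Klein form 64. *)
  exact: (@paired_values_64 klein_form 64 m 0 0 1 0 1 0 0 0).
Qed.

Local Open Scope classical_set_scope.

Theorem theorem3p1 :
  [/\ int_group_dets ('Z_4 * 'Z_2)%type
        = [set 8 * m + 1 | m in [set: int]]
          `|` [set 2 ^+ 8 * m | m in [set: int]],
      int_group_dets 'Q_8
        = int_group_dets ('Z_4 * 'Z_2)%type
          `|` [set z : int | exists (m : int) (p : nat),
                 [/\ prime p, p = 3 %[mod 4]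
                   & z = (8 * m - 3) * (p%:Z) ^+ 2]]
    & int_group_dets ('Z_2 * 'Z_2 * 'Z_2)%type
        = [set 8 * m + 1 | m in [set: int]]
          `|` [set 2 ^+ 8 * (4 * m + 1) | m in [set: int]]
          `|` [set 2 ^+ 12 * m | m in [set: int]]].
Proof.
split; apply/seteqP; split=> D /=.
- case/int_group_dets_Z4Z2P => [D1|/dvdzP[m ->]]; [left|right].
    by exists (D %/ 8)%Z => //; lia.
  by exists m => //; rewrite mulrC.
- case=> -[m _ <-]; apply/int_group_dets_Z4Z2P; [left|right]; first by lia.
  exact: dvdz_mulr.
- case/int_group_dets_Q8P => [D1|D0|]; last by right.
    by left; apply/int_group_dets_Z4Z2P; left.
  by left; apply/int_group_dets_Z4Z2P; right.
- case=> [/int_group_dets_Z4Z2P[D1|D0]|ex]; apply/int_group_dets_Q8P.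
  + by constructor 1.
  + by constructor 2.
  + by constructor 3.
- case/int_group_dets_Z2Z2Z2P => [D1|D256|/dvdzP[m ->]].
  + by left; left; exists (D %/ 8)%Z => //; lia.
  + left; right; exists (D %/ 1024)%Z => //.
    by rewrite [RHS](divz_eq D 1024) D256; ring.
  + by right; exists m => //; rewrite mulrC.
- case=> [[] [m _ <-]|[m _ <-]]; apply/int_group_dets_Z2Z2Z2P.
  + by constructor 1; lia.
  + constructor 2; have -> : 2 ^+ 8 * (4 * m + 1) = m * 1024 + 256 by ring.
    by clear; lia.
  + by constructor 3; apply: dvdz_mulr.
Qed.
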